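(* Let $D$ be a strong Mori domain and let $S$ be a multiplicative subset of $D$. If $D$ is a $w$-Hilbert domain, then the ring of fractions $D_S$ is a $w$-Hilbert domain.
   Context: Let $D$ be an integral domain with quotient field $K$. For a nonzero fractional ideal $I$ of $D$ put $I^{-1}=\{a\in K \mid aI\subseteq D\}$. A Glaz-Vasconcelos ideal (GV-ideal) of $D$ is a (nonzero) finitely generated ideal $J$ of $D$ with $J^{-1}=D$; the set of these is $\mathrm{GV}(D)$. The $w$-envelope of a nonzero fractional ideal $I$ is $I_w=\{a\in K \mid aJ\subseteq I \text{ for some } J\in \mathrm{GV}(D)\}$. An ideal $I$ of $D$ is a $w$-ideal if $I_w=I$; since the $w$-operation is defined only on nonzero fractional ideals, $w$-ideals are nonzero. A maximal $w$-ideal is a proper $w$-ideal that is not properly contained in any proper $w$-ideal. A prime $w$-ideal is an ideal that is both a prime ideal and a $w$-ideal (in particular, it is nonzero). $D$ is a $w$-Hilbert domain if every prime $w$-ideal of $D$ can be expressed as an intersection of maximal $w$-ideals of $D$. $D$ is a strong Mori domain if it satisfies the ascending chain condition on $w$-ideals. A multiplicative subset $S$ of $D$ is a subset that contains $1$, is closed under multiplication and does not contain $0$, and $D_S$ is the ring of fractions of $D$ with respect to $S$, which is an integral domain; the notions above for $D_S$ are taken with respect to the ring $D_S$ itself. *)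

(* Defs.v *)
From HB Require Import structures.
From mathcomp Require Import all_boot all_algebra.
From mathcomp Require Import boolp classical_sets.

Set Implicit Arguments.
Unset Strict Implicit.
Unset Printing Implicit Defensive.

Import GRing.Theory.

Local Open Scope ring_scope.
Local Open Scope classical_set_scope.

Local Notation "x %:F" := (@FracField.tofrac _ x).

Section Ideals.
Variable D : idomainType.
Implicit Types (I J M P : set D) (A : set {fraction D}).

(* Not idealr_closed, which also requires 1 \notin I and so rules out the unit
   ideal. *)
Definition ideal I : Prop := I 0 /\ forall a x y, I x -> I y -> I (a * x + y).

Definition prime_ideal P : Prop :=
  idealr_closed (mem P) /\ prime_idealr_closed (mem P).

Definition generated_by (n : nat) (g : 'I_n -> D) : set D :=
  [set x | exists c : 'I_n -> D, x = \sum_(i < n) c i * g i].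

Definition finitely_generated I : Prop :=
  exists (n : nat) (g : 'I_n -> D), I = generated_by g.

Definition in_frac I : set {fraction D} := [set x%:F | x in I].

Definition frac_inverse A : set {fraction D} :=
  [set a | forall x, A x -> in_frac setT (a * x)].

(* J = 0 has to be excluded by hand: when D is a field, its inverse is D. *)
Definition GV_ideal J : Prop :=
  [/\ finitely_generated J, J <> [set 0]
    & frac_inverse (in_frac J) = in_frac setT].

Definition w_envelope A : set {fraction D} :=
  [set a | exists2 J, GV_ideal J & forall x, J x -> A (a * x%:F)].

Definition w_ideal I : Prop :=
  [/\ ideal I, I <> [set 0] & w_envelope (in_frac I) = in_frac I].

Definition proper_w_ideal I : Prop := w_ideal I /\ I <> setT.

Definition maximal_w_ideal M : Prop :=
  proper_w_ideal M /\ forall I, proper_w_ideal I -> M `<=` I -> I = M.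

Definition prime_w_ideal P : Prop := prime_ideal P /\ w_ideal P.

End Ideals.

Definition w_Hilbert (D : idomainType) : Prop :=
  forall P : set D, prime_w_ideal P ->
    exists2 F : set (set D), F `<=` @maximal_w_ideal D
                           & P = \bigcap_(M in F) M.

Definition strong_Mori (D : idomainType) : Prop :=
  forall I : nat -> set D,
    (forall n, w_ideal (I n)) -> (forall n, I n `<=` I n.+1) ->
    exists N, forall n, (N <= n)%N -> I n = I N.

Definition multiplicative_subset (D : idomainType) (S : set D) : Prop :=
  mulr_closed (mem S) /\ ~ S 0.

Definition fractions (D : idomainType) (S : set D) : set {fraction D} :=
  [set z | exists a s, S s /\ z = a%:F / s%:F].

(* D_S as a ring in its own right, carried by the fractions a / s of
   {fraction D}. The proof that S is multiplicative is a parameter of the type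
   so that the ring structure can be found by unification. *)
Definition ring_of_fractions (D : idomainType) (S : set D)
    (hS : multiplicative_subset S) : Type :=
  {z : {fraction D} | z \in fractions S}.

Section RingOfFractions.
Variables (D : idomainType) (S : set D) (hS : multiplicative_subset S).

Local Notation DS := (ring_of_fractions hS).

Lemma mult_neq0 s : S s -> s%:F != 0 :> {fraction D}.
Proof.
by case: hS => _ S0 Ss; rewrite tofrac_eq0; apply/eqP => s0; rewrite s0 in Ss.
Qed.

Lemma fractions_subring : subring_closed (mem (fractions S)).
Proof.
have [[/set_mem S1 SM'] _] := hS.
have SM x y : S x -> S y -> S (x * y).
  by move=> Sx Sy; apply/set_mem/SM'; apply/mem_set.
split.
- by apply/mem_set; exists 1, 1; rewrite tofrac1 divr1.
- move=> _ _ /set_mem[a [s [Ss ->]]] /set_mem[b [t [St ->]]]; apply/mem_set.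
  exists (a * t - b * s), (s * t); split; first exact: SM.
  rewrite -mulNr addf_div ?mult_neq0 // mulNr.
  by rewrite tofracB !tofracM.
- move=> _ _ /set_mem[a [s [Ss ->]]] /set_mem[b [t [St ->]]]; apply/mem_set.
  exists (a * b), (s * t); split; first exact: SM.
  by rewrite mulf_div !tofracM.
Qed.

HB.instance Definition _ := [isSub of DS for @sval _ _].
HB.instance Definition _ := [Choice of DS by <:].
HB.instance Definition _ :=
  GRing.SubChoice_isSubComNzRing.Build _ _ DS fractions_subring.

Definition fractions_unit : {pred DS} := fun z => `[< exists y, y * z = 1 >].

Definition fractions_inv (z : DS) : DS :=
  if pselect (exists y, y * z = 1) is left ex then projT1 (cid ex) else z.

Lemma fractions_mulVx :
  {in fractions_unit, left_inverse 1 fractions_inv *%R}.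
Proof.
move=> z /asboolP Uz; rewrite /fractions_inv.
by case: pselect => // ex; case: cid.
Qed.

Lemma fractions_unitP (z y : DS) : y * z = 1 -> fractions_unit z.
Proof. by move=> yz; apply/asboolP; exists y. Qed.

Lemma fractions_inv_out : {in [predC fractions_unit], fractions_inv =1 id}.
Proof.
move=> z /asboolP nUz; rewrite /fractions_inv.
by case: pselect.
Qed.

HB.instance Definition _ := GRing.ComNzRing_hasMulInverse.Build DS
  fractions_mulVx fractions_unitP fractions_inv_out.

Lemma fractions_integral : GRing.integral_domain_axiom DS.
Proof.
move=> x y xy0; rewrite -!(inj_eq val_inj) rmorph0 -mulf_eq0 -rmorphM xy0.
by rewrite rmorph0.
Qed.

HB.instance Definition _ :=
  GRing.ComUnitRing_isIntegral.Build DS fractions_integral.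

End RingOfFractions.

(* Main.v *)
(** A nonzero prime w-ideal [P] of a strong Mori domain which is an intersection
    of maximal w-ideals is itself maximal: every maximal w-ideal is a conductor
    [(bD : e)], and for [0 <> p \in P] the ascending chain condition on the
    ideals [(pD : M_1 \cap ... \cap M_n)] reduces the intersection to a finite
    one, which, [P] being prime, has a single term. So in a strong Mori w-Hilbert
    domain all prime w-ideals are maximal w-ideals. Contraction sends proper
    w-ideals of [D_S] injectively to proper w-ideals of [D], hence the same
    holds in [D_S]. *)

Require Import Defs.
From mathcomp Require Import all_boot all_algebra.
From mathcomp Require Import boolp classical_sets.
From mathcomp Require Import ring.

Set Implicit Arguments.
Unset Strict Implicit.
Unset Printing Implicit Defensive.

Import GRing.Theory.

Local Open Scope ring_scope.
Local Open Scope classical_set_scope.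

Local Notation "x %:F" := (@FracField.tofrac _ x).
Local Notation "b %|| a" := (exists c, a = c * b) (at level 70).

(** * Ideals, GV-ideals and w-ideals, described by divisibility in [D] *)

Section Domain.
Variable D : idomainType.
Implicit Types (I J M P : set D) (T : set (D * D)).

Lemma tofrac_inj : injective (@FracField.tofrac D).
Proof. by move=> x y /eqP; rewrite tofrac_eq => /eqP. Qed.

Lemma in_fracE I x : in_frac I x%:F <-> I x.
Proof. by split=> [[y Iy /tofrac_inj <-] //|Ix]; exists x. Qed.

Lemma fractionP (z : {fraction D}) : exists a b, b != 0 /\ z = a%:F / b%:F.
Proof.
elim/quotW: z => r; have d0 := denom_ratioP r.
exists (frac r).1, (frac r).2; split=> //.
have dF0 : (frac r).2%:F != 0 by rewrite tofrac_eq0.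
apply: (mulIf dF0); rewrite divfK //; unlock FracField.tofrac.
rewrite -[LHS]FracField.pi_mul; apply/eqmodP.
rewrite /= FracField.equivfE /FracField.mulf !numden_Ratio ?oner_eq0 ?mulr1 //.
by rewrite mulrC.
Qed.

Lemma in_frac_divP (a b : D) : b != 0 -> in_frac setT (a%:F / b%:F) <-> b %|| a.
Proof.
move=> b0; have bF0 : b%:F != 0 by rewrite tofrac_eq0.
split=> [[c _ /(congr1 ( *%R^~ b%:F))]|[c ->]].
  by rewrite divfK // -tofracM => /tofrac_inj cb; exists c.
by exists c => //; rewrite tofracM mulfK.
Qed.

Lemma idealMl I a x : ideal I -> I x -> I (a * x).
Proof. by move=> [I0 Ilin] Ix; rewrite -[_ * _]addr0; apply: Ilin. Qed.

Lemma ideal1 I : ideal I -> I 1 -> I = setT.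
Proof.
by move=> iI I1; apply/seteqP; split=> // x _; rewrite -[x]mulr1; apply: idealMl.
Qed.

Lemma ideal_nz I : ideal I -> I <> [set 0] <-> exists2 x, I x & x != 0.
Proof.
move=> [I0 _]; split=> [In0|[x Ix x0] Ie].
  apply: contrapT => nex; apply: In0; apply/seteqP; split=> [x Ix|_ ->] //=.
  by apply/eqP/negPn/negP => x0; apply: nex; exists x.
by move: Ix; rewrite Ie => /= x0'; rewrite x0' eqxx in x0.
Qed.

Lemma ideal_generated n (g : 'I_n -> D) : ideal (generated_by g).
Proof.
split.
  by exists (fun=> 0); rewrite big1 // => i _; rewrite mul0r.
move=> a _ _ [c ->] [d ->]; exists (fun i => a * c i + d i).
rewrite mulr_sumr -big_split /=; apply: eq_bigr => i _.
by rewrite mulrDl mulrA.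
Qed.

Lemma generated_gen n (g : 'I_n -> D) i : generated_by g (g i).
Proof.
exists (fun j => (j == i)%:R); rewrite (bigD1 i) //= eqxx mul1r big1 ?addr0 //.
by move=> j /negPf ->; rewrite mul0r.
Qed.

Lemma generated_sub n (g : 'I_n -> D) I :
  ideal I -> (forall i, I (g i)) -> generated_by g `<=` I.
Proof.
move=> iI Ig _ [c ->]; elim/big_ind: _ => [|x y Ix Iy|i _].
- by case: iI.
- by rewrite -[x]mul1r; apply: (proj2 iI).
- exact: idealMl.
Qed.

(** Writing elements of the quotient field as [a / b] turns the condition [J^-1 = D] into
    divisibility, so that later arguments can stay inside [D]. *)
Lemma GV_idealP J : GV_ideal J <->
  [/\ finitely_generated J, J <> [set 0]
    & forall a b, b != 0 -> (forall x, J x -> b %|| a * x) -> b %|| a].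
Proof.
split=> -[fJ J0 JD]; split=> //.
  move=> a b b0 Jab; apply/in_frac_divP => //; rewrite -JD.
  by move=> _ [x Jx <-]; rewrite mulrAC -tofracM; apply/in_frac_divP/Jab.
apply/seteqP; split=> [z Jz|_ [x _ <-] _ [y _ <-]]; last first.
  by exists (x * y); rewrite ?tofracM.
have [a [b [b0 zE]]] := fractionP z; rewrite zE.
apply/in_frac_divP => //; apply: JD => // x Jx; apply/in_frac_divP => //.
by rewrite tofracM mulrAC -zE; apply: Jz; exists x.
Qed.

Lemma GV_setT : GV_ideal [set: D].
Proof.
apply/GV_idealP; split.
- exists 1%N, (fun=> 1); apply/seteqP; split=> // x _.
  by exists (fun=> x); rewrite big_ord1 mulr1.
- by move=> /seteqP[/(_ 1 I) /= /eqP]; rewrite oner_eq0.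
- by move=> a b _ /(_ 1 I); rewrite mulr1.
Qed.

(** It suffices to test elements of [D]: if [z J] lies in [I], then it lies in [D], so [z] is in
    [J^-1 = D]. *)
Lemma w_idealP I : w_ideal I <->
  [/\ ideal I, I <> [set 0] & forall J x, GV_ideal J ->
       (forall y, J y -> I (x * y)) -> I x].
Proof.
split=> -[iI I0 Iw]; split=> //.
  move=> J x GJ Jx; apply/in_fracE; rewrite -Iw; exists J => // y Jy.
  by rewrite -tofracM; apply/in_fracE/Jx.
apply/seteqP; split=> [z [J GJ Jz]|_ [x Ix <-]]; last first.
  exists setT; first exact: GV_setT.
  by move=> y _; rewrite -tofracM; apply/in_fracE; rewrite mulrC; apply: idealMl.
have [_ _ JD] := GJ.
have [x _ xz] : in_frac setT z.
  rewrite -JD => _ [y Jy <-]; have [v _ <-] := Jz _ Jy.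
  by exists v.
rewrite -xz in Jz *; apply/in_fracE/(Iw J) => // y Jy.
by apply/in_fracE; rewrite tofracM; apply: Jz.
Qed.

(* A pair [(a, b)] stands for the fraction [a / b], so that the conductor of [T]
   is [{x | T x \subset D}]. *)
Definition conductor T : set D := [set x | forall t, T t -> t.2 %|| t.1 * x].

Lemma ideal_conductor T : ideal (conductor T).
Proof.
split=> [t _|a x y Cx Cy t Tt]; first by exists 0; rewrite mulr0 mul0r.
have [c cx] := Cx t Tt; have [d dy] := Cy t Tt.
by exists (a * c + d); rewrite mulrDr mulrCA cx dy; ring.
Qed.

(** If [y J] lies in the conductor for a GV-ideal [J], then each [a / b] of [T] satisfies
    [(a / b) y J] in [D], whence [(a / b) y] is in [J^-1 = D]. The element [x] witnesses that the
    conductor is nonzero. *)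
Lemma w_ideal_conductor T x : (forall t, T t -> t.2 != 0) -> x != 0 ->
  conductor T x -> w_ideal (conductor T).
Proof.
move=> T0 x0 Cx; apply/w_idealP; split; first exact: ideal_conductor.
  by apply/ideal_nz; [exact: ideal_conductor | exists x].
move=> J y /GV_idealP[_ _ JD] Jy t Tt; apply: JD; first exact: T0.
by move=> z Jz; rewrite -mulrA; apply: Jy.
Qed.

(** * Consequences of the chain condition on w-ideals *)

(** Otherwise any list in [A] could be lengthened so as to enlarge [V s] strictly, and iterating
    from the empty list would give a strictly increasing chain. *)
Lemma strong_Mori_stationary (E : choiceType) (A : set E) (V : seq E -> set D) :
  strong_Mori D -> (forall s, w_ideal (V s)) ->
  (forall x s, V s `<=` V (x :: s)) ->
  exists2 s, {in s, forall x, A x} & forall x, A x -> V (x :: s) = V s.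
Proof.
move=> SM Vw Vle; apply: contrapT => nex.
(* The guard on [s] sits under the existential so that [choice] yields a total function, which can
   be iterated. *)
have step s : exists s', {in s, forall x, A x} ->
    [/\ {in s', forall x, A x}, V s `<=` V s' & V s' <> V s].
  have [sA|nsA] := pselect {in s, forall x, A x}; last by exists s.
  apply: contrapT => ns; apply: nex; exists s => // x Ax.
  apply: contrapT => nV; apply: ns; exists (x :: s) => _; split=> // y.
  by rewrite inE => /predU1P[->|/sA].
have [f fP] := choice step; pose s n := iter n f [::].
have sA n : {in s n, forall x, A x} by elim: n => //= n /fP[].
have [||N NP] := SM (V \o s); [by move=> n; apply: Vw|by move=> n; case: (fP _ (sA n))|].
by have [_ _] := fP _ (sA N); apply; apply: (NP N.+1).
Qed.

(* [(J^-1)^-1] *)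
Definition v_closure J : set D :=
  conductor [set t | t.2 != 0 /\ forall y, J y -> t.2 %|| t.1 * y].

Lemma sub_v_closure J : J `<=` v_closure J.
Proof. by move=> x Jx t [_]; apply. Qed.

Lemma v_closure_sub I J : I `<=` J -> v_closure I `<=` v_closure J.
Proof. by move=> IJ x Ix t [t0 Jt]; apply: Ix; split=> // y /IJ; apply: Jt. Qed.

(** The v-closures of finitely generated subideals of [M] are conductors, hence w-ideals. Once
    adjoining any [x] of [M] leaves the v-closure unchanged, it already contains [x]. *)
Lemma w_ideal_subset_v_fg M : strong_Mori D -> w_ideal M ->
  exists J, [/\ finitely_generated J, J <> [set 0], J `<=` M
              & M `<=` v_closure J].
Proof.
move=> SM [iM /ideal_nz-/(_ iM)[m Mm m0] _].
(* The nonzero [m] is put in front of every list to keep [G s] nonzero, even for the empty list. *)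
pose G (s : seq D) := generated_by (fun i : 'I_(size (m :: s)) => (m :: s)`_i).
have Gmem s x : x \in m :: s -> G s x.
  move=> /nthP-/(_ 0)[i si <-].
  exact: (generated_gen (fun i : 'I_(size (m :: s)) => (m :: s)`_i) (Ordinal si)).
have iG s : ideal (G s) by exact: ideal_generated.
have GS x s : G s `<=` G (x :: s).
  apply: generated_sub => // i; apply: Gmem.
  have := mem_nth 0 (ltn_ord i); rewrite !inE => /orP[->//|->].
  by rewrite !orbT.
have [s sM sV] : exists2 s, {in s, forall x, M x} &
    forall x, M x -> v_closure (G (x :: s)) = v_closure (G s).
  apply: (@strong_Mori_stationary D M (fun s => v_closure (G s))) => //.
    move=> s; apply: (w_ideal_conductor _ m0) => [t []//|].
    by apply/sub_v_closure/Gmem/mem_head.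
  by move=> x s; apply/v_closure_sub/GS.
exists (G s); split.
- by exists (size (m :: s)), (fun i => (m :: s)`_i).
- by apply/ideal_nz => //; exists m => //; apply/Gmem/mem_head.
- apply: generated_sub => // i.
  have := mem_nth 0 (ltn_ord i); rewrite inE => /predU1P[->//|]; exact: sM.
- move=> x Mx; rewrite -(sV x Mx); apply/sub_v_closure/Gmem.
  by rewrite !inE eqxx orbT.
Qed.

(** Take [J] finitely generated inside [M] with [M] in its v-closure. It is not a GV-ideal, since
    otherwise [1] would be in [M]; so some [e / b] outside [D] sends [J], hence also [M], into [D].
    Its conductor is a proper w-ideal containing [M]. *)
Lemma maximal_w_conductor M : strong_Mori D -> maximal_w_ideal M ->
  exists e b, b != 0 /\ M = [set x | b %|| e * x].
Proof.
move=> SM [[wM MT] Mmax]; have /w_idealP[iM Mn0 Mw] := wM.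
have [J [fJ J0 JM MJ]] := w_ideal_subset_v_fg SM wM.
have [e [b [b0 Mb nb]]] : exists e b,
    [/\ b != 0, forall x, M x -> b %|| e * x & ~ b %|| e].
  apply: contrapT => nex; apply: MT; apply: ideal1 => //.
  apply: (Mw J) => [|y Jy]; last by rewrite mul1r; apply: JM.
  apply/GV_idealP; split=> // e b b0 Jb; apply: contrapT => nb.
  apply: nex; exists e, b; split=> // x Mx.
  exact: (MJ x Mx (e, b)).
have CE : conductor [set (e, b)] = [set x | b %|| e * x].
  by apply/seteqP; split=> [x /(_ (e, b) erefl)//|x Cx _ ->].
exists e, b; split=> //; rewrite -CE; apply/esym/Mmax; last first.
  by move=> x Mx; rewrite CE; apply: Mb.
split=> [|CT].
  have /ideal_nz-/(_ iM)[m Mm m0] := Mn0.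
  apply: (w_ideal_conductor _ m0) => [_ ->//|].
  by rewrite CE; apply: Mb.
by apply: nb; have : [set: D] 1 by []; rewrite -CT CE /= mulr1.
Qed.

(** * Prime w-ideals that are intersections of maximal w-ideals *)

Lemma prime_idealE P : prime_ideal P <->
  [/\ ideal P, ~ P 1 & forall x y, P (x * y) -> P x \/ P y].
Proof.
split=> [[[P0 P1 PD] Pp]|[[P0 PD] P1 Pp]].
  split.
  - split=> [|a x y Px Py]; first exact/set_mem.
    by apply/set_mem/PD; apply/mem_set.
  - by move/mem_set; apply/negP.
  - by move=> x y /mem_set/Pp/orP[]/set_mem; [left|right].
split; first split.
- exact/mem_set.
- by apply/negP => /set_mem.
- by move=> a x y /set_mem Px /set_mem Py; apply/mem_set/PD.
- by move=> x y /set_mem/Pp[]/mem_set Hx; apply/orP; [left|right].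
Qed.

(** If [x] is in the first ideal but not in [P], then [y * x] is in [P] for every [y] in the
    intersection of the others, so that intersection lies in [P] and induction applies. *)
Lemma prime_finite_cap P (s : seq (set D)) : prime_ideal P ->
  {in s, forall M, ideal M} ->
  foldr setI setT s `<=` P -> exists2 M, M \in s & M `<=` P.
Proof.
move=> /prime_idealE[iP P1 Pp]; elim: s => [_ /(_ 1 I)//|M s IHs iMs /= sP].
have [MP|nMP] := pselect (M `<=` P); first by exists M; rewrite ?mem_head.
have [x [Mx nPx]] : exists x, M x /\ ~ P x.
  apply: contrapT => nx; apply: nMP => x Mx.
  by apply: contrapT => nPx; apply: nx; exists x.
have [|y sy|N sN NP] := IHs.
- by move=> N sN; apply: iMs; rewrite inE sN orbT.
- have: P (y * x).
    apply: sP; split; first by apply: idealMl => //; apply/iMs/mem_head.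
    elim: s sy iMs {IHs} => //= N s IHs [Ny sy] iMs; split.
      by rewrite mulrC; apply: idealMl => //; apply: iMs; rewrite !inE eqxx orbT.
    apply: IHs => // L; rewrite inE => /orP LMs; apply: iMs.
    by case: LMs => Ls; rewrite !inE Ls ?orbT.
  by case/Pp.
- by exists N; rewrite ?inE ?sN ?orbT.
Qed.

Lemma prime_w_maximal P : strong_Mori D -> w_Hilbert D -> prime_w_ideal P ->
  maximal_w_ideal P.
Proof.
move=> SM wH pwP; have [F FM PF] := wH P pwP.
have [pP [iP /ideal_nz-/(_ iP)[p Pp p0] _]] := pwP.
have PsubF M : F M -> P `<=` M by move=> FM' x; rewrite PF; apply.
(* [V s] is the ideal [(pD : M_1 \cap ... \cap M_n)] for [s = M_1, ..., M_n]. *)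
pose V (s : seq (set D)) := conductor [set t | foldr setI setT s t.1 /\ t.2 = p].
have [s sF sV] : exists2 s, {in s, forall M, F M} &
    forall M, F M -> V (M :: s) = V s.
  apply: strong_Mori_stationary => // [s|M s x Vx t [[_ st] tp]]; last exact: Vx.
  by apply: (w_ideal_conductor _ p0) => -[y _] [_ /= ->] //; exists y.
have sP : foldr setI setT s `<=` P.
  rewrite PF => y sy M FM'.
  have [e [b [b0 ME]]] := maximal_w_conductor SM (FM _ FM').
  (* Here [q / p = e / b], so [q] sends [M] into [pD] and lies in [V (M :: s) = V s]. Thus [p]
     divides [y * q], that is, [b] divides [e * y]. *)
  have [q eq] : b %|| e * p by have := PsubF M FM' p Pp; rewrite {1}ME.
  have : V s q.
    rewrite -(sV M FM') => -[z _] [/= [Mz _] ->].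
    move: Mz; rewrite ME => -[c ec]; exists c; apply: (mulIf b0).
    by rewrite -mulrA -eq [RHS]mulrAC -ec; ring.
  move=> /(_ (y, p))[//|/= c yc]; rewrite ME; exists c.
  by apply: (mulIf p0); rewrite mulrAC eq mulrAC [q * y]mulrC yc; ring.
have [M /sF FM' MP] : exists2 M, M \in s & M `<=` P.
  apply: prime_finite_cap => // M /sF/FM; by case=> -[[]].
suff -> : P = M by apply: FM.
by apply/seteqP; split=> //; apply: PsubF.
Qed.

End Domain.

(** * Extension of GV-ideals to [D_S] and contraction of w-ideals to [D] *)

Section Localization.
Variables (D : idomainType) (S : set D) (hS : multiplicative_subset S).
Local Notation DS := (ring_of_fractions hS).

Lemma mult1 : S 1.
Proof. by have [[/set_mem]] := hS. Qed.

Lemma multM s t : S s -> S t -> S (s * t).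
Proof.
by have [[_ SM] _] := hS; move=> Ss St; apply/set_mem/SM; apply/mem_set.
Qed.

Lemma fractions_tofrac x : x%:F \in fractions S.
Proof. by apply/mem_set; exists x, 1; split; [exact: mult1|rewrite tofrac1 divr1]. Qed.

Definition loc (x : D) : DS := Sub x%:F (fractions_tofrac x).

Lemma val_loc x : val (loc x) = x%:F. Proof. exact: SubK. Qed.

Lemma val_ringM (x y : DS) : val (x * y) = val x * val y.
Proof. exact: rmorphM. Qed.

Lemma loc_inj : injective loc.
Proof. by move=> x y /(congr1 val); rewrite !val_loc => /tofrac_inj. Qed.

Lemma locM : {morph loc : x y / x * y}.
Proof. by move=> x y; apply: val_inj; rewrite val_ringM !val_loc tofracM. Qed.

Lemma locD : {morph loc : x y / x + y}.
Proof. by move=> x y; apply: val_inj; rewrite rmorphD !val_loc tofracD. Qed.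

Lemma loc0 : loc 0 = 0.
Proof. by apply: val_inj; rewrite rmorph0 val_loc tofrac0. Qed.

Lemma loc1 : loc 1 = 1.
Proof. by apply: val_inj; rewrite rmorph1 val_loc tofrac1. Qed.

Lemma loc_eq0 x : (loc x == 0) = (x == 0).
Proof. by rewrite -loc0 (inj_eq loc_inj). Qed.

Lemma loc_inv s : S s -> exists u, u * loc s = 1.
Proof.
move=> Ss.
have uP : 1%:F / s%:F \in fractions S by apply/mem_set; exists 1, s.
exists (Sub (1%:F / s%:F) uP : DS); apply: val_inj.
rewrite val_ringM val_loc SubK tofrac1 divfK ?rmorph1 //; exact: (mult_neq0 hS).
Qed.

Lemma loc_clear (z : DS) : exists a s, S s /\ loc s * z = loc a.
Proof.
have /set_mem[a [s [Ss zE]]] := valP z; exists a, s; split=> //.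
apply: val_inj; rewrite val_ringM !val_loc /= zE mulrC divfK //.
exact: (mult_neq0 hS).
Qed.

Lemma mult_nz s : S s -> s != 0.
Proof. by move=> Ss; rewrite -tofrac_eq0 (mult_neq0 hS). Qed.

(** Finite generation provides a common denominator: if [a / b] sends every generator into [D_S],
    clearing denominators gives a divisibility in [D], to which the GV property of [g] applies. *)
Lemma GV_extension n (g : 'I_n -> D) :
  GV_ideal (generated_by g) -> GV_ideal (generated_by (loc \o g)).
Proof.
move=> /GV_idealP[_ gn0 gD]; apply/GV_idealP; split.
- by exists n, (loc \o g).
- apply/ideal_nz; first exact: ideal_generated.
  have [i gi0] : exists i, g i != 0.
    apply: contrapT => ng.
    have /ideal_nz-/(_ (ideal_generated g))[_ [c ->]] := gn0.
    rewrite big1 ?eqxx // => i _.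
    suff -> : g i = 0 by rewrite mulr0.
    by apply/eqP/negPn/negP => gi; apply: ng; exists i.
  by exists (loc (g i)); [exact: (generated_gen (loc \o g))|rewrite loc_eq0].
move=> a b b0 gab.
have [alpha [s [Ss sa]]] := loc_clear a; have [beta [t [St tb]]] := loc_clear b.
have bet0 : beta != 0 by rewrite -loc_eq0 -tb mulf_neq0 // loc_eq0 mult_nz.
have /choice[u uP] i : exists u, S u /\ beta %|| (alpha * t * u) * g i.
  have [c gc] := gab _ (generated_gen (loc \o g) i).
  have [gam [u [Su uc]]] := loc_clear c.
  exists u; split=> //; exists (s * gam); apply: loc_inj.
  rewrite !locM -sa -tb -uc.
  transitivity (loc s * loc t * loc u * (a * loc (g i))); first by ring.
  by rewrite gc; ring.
pose w := \prod_i u i.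
have Sw : S w.
  rewrite /w; elim/big_ind: _ => [|x y|i _]; [exact: mult1|exact: multM|].
  by have [] := uP i.
have [d dE] : beta %|| alpha * t * w.
  apply: gD => //; pose T := [set (alpha * t * w, beta)].
  have CT : conductor T = [set x | beta %|| alpha * t * w * x].
    by apply/seteqP; split=> [x /(_ _ erefl)//|x Cx _ ->].
  rewrite -[forall x, _]/(generated_by g `<=` [set x | beta %|| alpha * t * w * x]).
  rewrite -CT; apply: generated_sub; first exact: ideal_conductor.
  move=> i; rewrite CT; have [_ [c cE]] := uP i.
  exists (c * \prod_(j | j != i) u j).
  by rewrite /w (bigD1 i) //= [RHS]mulrAC -cE; ring.
(* Since [alpha = s a] and [beta = t b] in [D_S], the relation [alpha t w = d beta] reads
   [s w t a = d t b]. Then [t] cancels and [s w] is inverted. *)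
have [v vs] := loc_inv (multM Ss Sw).
exists (v * loc d).
have t0 : loc t != 0 by rewrite loc_eq0 mult_nz.
apply: (mulfI t0).
transitivity (v * loc (s * w) * (loc t * a)); first by rewrite vs mul1r.
transitivity (v * loc (alpha * t * w)); last first.
  by rewrite dE locM -tb; ring.
by rewrite !locM -sa; ring.
Qed.

(** If [x J] lies in the contraction for a GV-ideal [J] of [D], then [loc x] sends the extension of
    [J], a GV-ideal of [D_S], into [I]. *)
Lemma w_ideal_contraction (I : set DS) : w_ideal I -> w_ideal (loc @^-1` I).
Proof.
move=> /w_idealP[iI In0 Iw].
have iC : ideal (loc @^-1` I).
  split=> [|a x y Ix Iy]; rewrite /preimage /= ?loc0; first by case: iI.
  by rewrite locD locM; apply: (proj2 iI).
apply/w_idealP; split=> //.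
  apply/ideal_nz => //; have /ideal_nz-/(_ iI)[z Iz z0] := In0.
  have [a [s [Ss sz]]] := loc_clear z.
  exists a; first by rewrite /preimage /= -sz; apply: idealMl.
  by rewrite -loc_eq0 -sz mulf_neq0 // loc_eq0 mult_nz.
move=> J x GJ Jx; have [[n [g JE]] _ _] := GJ; rewrite JE in GJ Jx.
apply: (Iw _ _ (GV_extension GJ)) => _ [c ->]; rewrite mulr_sumr.
elim/big_ind: _ => [|y z Iy Iz|i _]; first by case: iI.
  by rewrite -[y]mul1r; apply: (proj2 iI).
rewrite mulrCA -locM; apply: idealMl => //; apply: Jx; exact: generated_gen.
Qed.

Lemma proper_w_contraction (I : set DS) :
  proper_w_ideal I -> proper_w_ideal (loc @^-1` I).
Proof.
move=> [wI IT]; split; first exact: w_ideal_contraction.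
move=> CT; apply: IT; apply: ideal1; first by case: wI.
by rewrite -loc1; change ((loc @^-1` I) 1); rewrite CT.
Qed.

(** Each element of [D_S] is a unit multiple of an element of [D], so an ideal is determined by its
    contraction. *)
Lemma contraction_sub (I J : set DS) : ideal I -> ideal J ->
  loc @^-1` I `<=` loc @^-1` J -> I `<=` J.
Proof.
move=> iI iJ IJ z Iz; have [a [s [Ss sz]]] := loc_clear z.
have [v vs] := loc_inv Ss.
rewrite -[z]mul1r -vs -mulrA; apply: idealMl => //; rewrite sz; apply: IJ.
by rewrite /preimage /= -sz; apply: idealMl.
Qed.

Lemma prime_contraction (Q : set DS) :
  prime_w_ideal Q -> prime_w_ideal (loc @^-1` Q).
Proof.
move=> [/prime_idealE[iQ Q1 Qp] wQ].
have wC := w_ideal_contraction wQ; split=> //.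
apply/prime_idealE; split; first by case: wC.
  by rewrite /preimage /= loc1.
by move=> x y; rewrite /preimage /= locM; apply: Qp.
Qed.

Lemma maximal_of_contraction (Q : set DS) : proper_w_ideal Q ->
  maximal_w_ideal (loc @^-1` Q) -> maximal_w_ideal Q.
Proof.
move=> pQ [_ Cmax]; split=> // I pI QI; apply/seteqP; split=> //.
apply: contraction_sub; [by case: pI => -[]|by case: pQ => -[]|].
by rewrite (Cmax _ (proper_w_contraction pI)) // => x; apply: QI.
Qed.

End Localization.

Theorem proposition2p7 (D : idomainType) (S : set D) (hS : multiplicative_subset S) :
  strong_Mori D -> w_Hilbert D -> w_Hilbert (ring_of_fractions hS).
Proof.
(* The one-element family suffices because [Q] itself is shown to be a maximal w-ideal. *)
move=> SM wH Q pwQ; exists [set Q]; last by rewrite bigcap_set1.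
move=> _ ->; apply: maximal_of_contraction.
  have [/prime_idealE[_ Q1 _] wQ] := pwQ; split=> // QT.
  by apply: Q1; rewrite QT.
exact: (prime_w_maximal SM wH (prime_contraction pwQ)).
Qed.
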